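(* Let $M$ be an inverse monoid, let $E(M)$ be its semilattice of idempotents, let $\sigma$ be the minimal group congruence on $M$, let $k \colon E(M) \to M$ be the inclusion and let $q \colon M \to M/\sigma$ be the quotient map. Then the diagram $E(M) \xrightarrow{k} M \xrightarrow{q} M/\sigma$ is a weakly Schreier extension if and only if $M$ is F-inverse.
   Context: A monoid $M$ is inverse if for each $x \in M$ there is a unique $x^{-1} \in M$ with $xx^{-1}x = x$ and $x^{-1}xx^{-1} = x^{-1}$. The set $E(M)$ of idempotents of $M$ is then a subsemilattice (commutative submonoid of idempotents). The natural order on $M$ is: $x \le y$ if there exists $e \in E(M)$ with $x = ey$. The congruence $\sigma$ is the smallest congruence on $M$ such that $M/\sigma$ is a group. An inverse monoid $M$ is F-inverse if each $\sigma$-class has a maximal (i.e. largest) element with respect to the natural order. A diagram of monoid homomorphisms $N \xrightarrow{k} G \xrightarrow{e} H$ is an extension if $k$ is the kernel of $e$ and $e$ is the cokernel of $k$ in the category of monoids. (Here the kernel of $e$ is the inclusion of the submonoid $e^{-1}(1)$, up to isomorphism, and the cokernel of $k$ is the quotient of $G$ by the smallest congruence identifying every $k(n)$ with $1$, up to isomorphism.) An extension $N \xrightarrow{k} G \xrightarrow{e} H$ is weakly Schreier if there exists a set-theoretic splitting $s \colon H \to G$ of $e$ (a function with $e s = \mathrm{id}_H$) such that for all $g \in G$ there exists $n \in N$ with $g = k(n)\, s(e(g))$. *)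

(* Defs.v *)
From HB Require Import structures.
From mathcomp Require Import all_boot boolp.

Set Implicit Arguments.
Unset Strict Implicit.
Unset Printing Implicit Defensive.

Local Open Scope group_scope.
Local Open Scope quotient_scope.

(* The category of monoids is taken on the objects of monoidType, which carry
   a choiceType structure (classically, every type has one), with equality of
   morphisms read pointwise. *)
Notation mon_hom := UMagmaMorphism.type.

Definition is_group (M : monoidType) : Prop :=
  forall x : M, exists y : M, x * y = 1 /\ y * x = 1.

HB.mixin Record Monoid_isInverse M of monoid.Monoid M := {
  exists_unique_inverse :
    forall x : M, exists! y : M, x * y * x = x /\ y * x * y = y
}.

#[short(type="inverseMonoidType")]
HB.structure Definition InverseMonoid :=
  { M of Monoid_isInverse M & monoid.Monoid M }.

Definition idem (M : monoidType) : {pred M} := [pred x : M | x * x == x].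
Arguments idem : clear implicits.

Lemma idemP (M : monoidType) (x : M) : reflect (x * x = x) (x \in idem M).
Proof. exact: eqP. Qed.

Lemma inverse_uniq (M : inverseMonoidType) (x y z : M) :
  x * y * x = x -> y * x * y = y -> x * z * x = x -> z * x * z = z -> y = z.
Proof.
move=> xyx yxy xzx zxz; have [w [_ h]] := exists_unique_inverse x.
by rewrite -(h y) // -(h z).
Qed.

Lemma idem_mul (M : inverseMonoidType) (e f : M) :
  e * e = e -> f * f = f -> e * f * (e * f) = e * f.
Proof.
move=> ee ff; have [x [[h1 h2] _]] := exists_unique_inverse (e * f).
have eeA t : e * (e * t) = e * t by rewrite mulgA ee.
have ffA t : f * (f * t) = f * t by rewrite mulgA ff.
have h2A t : x * (e * (f * (x * t))) = x * t by rewrite -[in RHS]h2 !mulgA.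
have h : x = f * x * e.
  apply: (inverse_uniq h1 h2); rewrite -!mulgA.
  - by rewrite ffA eeA -[in RHS]h1 -!mulgA.
  - by rewrite eeA ffA h2A.
have xx : x * x = x by rewrite {1 2}h -!mulgA h2A mulgA -h.
have -> : e * f = x.
  by apply: (inverse_uniq h2 h1); rewrite !xx.
exact: xx.
Qed.

Lemma idem_comm (M : inverseMonoidType) (e f : M) :
  e * e = e -> f * f = f -> e * f = f * e.
Proof.
move=> ee ff; have ef := idem_mul ee ff; have fe := idem_mul ff ee.
have eeA t : e * (e * t) = e * t by rewrite mulgA ee.
have ffA t : f * (f * t) = f * t by rewrite mulgA ff.
apply: (@inverse_uniq _ (e * f)); rewrite ?ef //.
- by rewrite -!mulgA ffA eeA mulgA.
- by rewrite -!mulgA eeA ffA mulgA.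
Qed.

Lemma idem_umagma_closed (M : inverseMonoidType) : umagma_closed (idem M).
Proof.
split=> [|e f /idemP ee /idemP ff]; apply/idemP; first exact: mulg1.
exact: idem_mul.
Qed.

Record idempotents (M : inverseMonoidType) := Idempotent {
  idem_val : M;
  _ : idem_val \in idem M
}.

HB.instance Definition _ (M : inverseMonoidType) :=
  [isSub of idempotents M for @idem_val M].
HB.instance Definition _ (M : inverseMonoidType) :=
  [Choice of idempotents M by <:].
HB.instance Definition _ (M : inverseMonoidType) :=
  SubChoice_isSubMonoid.Build M (idem M) (idempotents M)
    (idem_umagma_closed M).

Definition idem_incl (M : inverseMonoidType) : mon_hom (idempotents M) M :=
  (val : idempotents M -> M).

Record congruence (M : monoidType) := Congruence {
  cong_rel :> equiv_rel M;
  congM : forall x x' y y' : M,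
    cong_rel x x' -> cong_rel y y' -> cong_rel (x * y) (x' * y')
}.

Definition quot (M : monoidType) (c : congruence M) : Type := {eq_quot c}.

HB.instance Definition _ (M : monoidType) (c : congruence M) :=
  Choice.on (quot c).
HB.instance Definition _ (M : monoidType) (c : congruence M) :=
  EqQuotient.on (quot c).

Definition quot_mul (M : monoidType) (c : congruence M) :
  quot c -> quot c -> quot c := lift_op2 (quot c) *%g.

Lemma pi_quot_mul (M : monoidType) (c : congruence M) (x y : M) :
  quot_mul (\pi_(quot c) x) (\pi_(quot c) y) = \pi_(quot c) (x * y).
Proof.
by rewrite /quot_mul -lock; apply/eqmodP; apply: congM; apply/eqmodP; rewrite reprK.
Qed.

Lemma quot_mulA (M : monoidType) (c : congruence M) :
  associative (@quot_mul M c).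
Proof.
move=> x y z; rewrite -[x]reprK -[y]reprK -[z]reprK.
by rewrite !pi_quot_mul mulgA.
Qed.

Lemma quot_mul1g (M : monoidType) (c : congruence M) :
  left_id (\pi_(quot c) 1) (@quot_mul M c).
Proof. by move=> x; rewrite -[x]reprK pi_quot_mul mul1g. Qed.

Lemma quot_mulg1 (M : monoidType) (c : congruence M) :
  right_id (\pi_(quot c) 1) (@quot_mul M c).
Proof. by move=> x; rewrite -[x]reprK pi_quot_mul mulg1. Qed.

HB.instance Definition _ (M : monoidType) (c : congruence M) :=
  isMonoid.Build (quot c)
    (@quot_mulA M c) (@quot_mul1g M c) (@quot_mulg1 M c).

Definition quot_proj_fun (M : monoidType) (c : congruence M) : M -> quot c :=
  \pi_(quot c).

Lemma quot_proj_morph (M : monoidType) (c : congruence M) :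
  monoid_morphism (@quot_proj_fun M c).
Proof. by split=> // x y; rewrite /quot_proj_fun -pi_quot_mul. Qed.

HB.instance Definition _ (M : monoidType) (c : congruence M) :=
  isUMagmaMorphism.Build M (quot c) (@quot_proj_fun M c)
    (@quot_proj_morph M c).

Definition quot_proj (M : monoidType) (c : congruence M) :
  mon_hom M (quot c) := @quot_proj_fun M c.

Lemma quot_projP (M : monoidType) (c : congruence M) (x y : M) :
  quot_proj c x = quot_proj c y <-> c x y.
Proof. by split=> /eqmodP. Qed.

(* The intersection of all congruences with group quotient; by sigma_is_group
   it is itself one of them when M is inverse, hence the smallest. *)
Definition sigma_rel (M : monoidType) : rel M := fun x y =>
  `[< forall c : congruence M, is_group (quot c) -> c x y >].

Lemma sigma_refl (M : monoidType) : reflexive (@sigma_rel M).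
Proof. by move=> x; apply/asboolP=> c _; apply: equiv_refl. Qed.

Lemma sigma_sym (M : monoidType) : symmetric (@sigma_rel M).
Proof.
by move=> x y; apply/asboolP/asboolP=> h c gc; rewrite equiv_sym; apply: h.
Qed.

Lemma sigma_trans (M : monoidType) : transitive (@sigma_rel M).
Proof.
move=> y x z /asboolP xy /asboolP yz; apply/asboolP=> c gc.
exact: equiv_trans (xy c gc) (yz c gc).
Qed.

Lemma sigma_mul (M : monoidType) (x x' y y' : M) :
  sigma_rel x x' -> sigma_rel y y' -> sigma_rel (x * y) (x' * y').
Proof.
move=> /asboolP xx' /asboolP yy'; apply/asboolP=> c gc.
exact: congM (xx' c gc) (yy' c gc).
Qed.

Definition sigma (M : monoidType) : congruence M :=
  @Congruence M
    (EquivRel (@sigma_rel M) (@sigma_refl M) (@sigma_sym M) (@sigma_trans M))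
    (@sigma_mul M).

Lemma sigma_min (M : monoidType) (c : congruence M) :
  is_group (quot c) -> forall x y : M, sigma M x y -> c x y.
Proof. by move=> gc x y /asboolP; apply. Qed.

Lemma sigma_is_group (M : inverseMonoidType) : is_group (quot (sigma M)).
Proof.
have idem1 (e : M) : e * e = e -> sigma M e 1.
  move=> ee; apply/asboolP=> c gc; apply/quot_projP.
  have [y [ey _]] := gc (quot_proj c e).
  by rewrite gmulf1 -[LHS]mulg1 -ey mulgA -gmulfM ee.
move=> z; rewrite -[z]reprK; set x := repr z.
have [y [[xyx yxy] _]] := exists_unique_inverse x.
exists (quot_proj _ y); rewrite -[\pi x]/(quot_proj _ x) -!gmulfM.
rewrite -[1](gmulf1 (s := quot_proj (sigma M))).
by split; apply/quot_projP; apply: idem1; rewrite mulgA ?xyx ?yxy.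
Qed.

Definition nat_le (M : inverseMonoidType) (x y : M) : Prop :=
  exists2 e : M, e \in idem M & x = e * y.

(* "Maximal" element of a sigma-class means greatest element. *)
Definition F_inverse (M : inverseMonoidType) : Prop :=
  forall x : M, exists2 m : M,
    sigma M x m & forall y : M, sigma M x y -> nat_le y m.

(* The zero morphisms of the category of monoids are the constant maps to 1. *)
Definition is_kernel (N G H : monoidType)
    (k : mon_hom N G) (e : mon_hom G H) : Prop :=
  (forall n : N, e (k n) = 1) /\
  forall (X : monoidType) (f : mon_hom X G), (forall x : X, e (f x) = 1) ->
    exists f' : mon_hom X N, k \o f' =1 f /\
      forall f'' : mon_hom X N, k \o f'' =1 f -> f'' =1 f'.

Definition is_cokernel (N G H : monoidType)
    (k : mon_hom N G) (e : mon_hom G H) : Prop :=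
  (forall n : N, e (k n) = 1) /\
  forall (X : monoidType) (f : mon_hom G X), (forall n : N, f (k n) = 1) ->
    exists f' : mon_hom H X, f' \o e =1 f /\
      forall f'' : mon_hom H X, f'' \o e =1 f -> f'' =1 f'.

Definition extension (N G H : monoidType)
    (k : mon_hom N G) (e : mon_hom G H) : Prop :=
  is_kernel k e /\ is_cokernel k e.

Definition weakly_schreier_extension (N G H : monoidType)
    (k : mon_hom N G) (e : mon_hom G H) : Prop :=
  extension k e /\
  exists s : H -> G, cancel s e /\
    forall g : G, exists n : N, g = k n * s (e g).

(* Main.v *)
From HB Require Import structures.
Require Import Defs.
From mathcomp Require Import all_boot boolp.

(** Being weakly Schreier through a splitting [s] means that every [g] is an
    idempotent multiple of [s (q g)], that is [g <= s (q g)] in the natural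
    order.  As [s (q g)] lies in the sigma-class of [g], a Schreier splitting is
    the same thing as a choice of a greatest element in each sigma-class.

    It remains to see that the diagram is an extension when [M] is F-inverse.
    The cokernel half, [sigma_is_cokernel], holds in every inverse monoid: a
    morphism [f] killing the idempotents sends [x * y] and [y * x] to [1] when
    [y] is the inverse of [x], so [M / ker f] is a group and [f] factors through
    sigma by minimality.  The kernel half says that the class of [1] consists of
    idempotents (M is E-unitary).  Here F-inversity enters: the greatest element
    of that class lies above [1], but [1] is maximal in the natural order, so
    the elements of the class are those below [1], which are idempotents. *)

Set Implicit Arguments.
Unset Strict Implicit.
Unset Printing Implicit Defensive.

Local Open Scope group_scope.
Local Open Scope quotient_scope.

Lemma quot_proj_repr (M : monoidType) (c : congruence M) (z : quot c) :
  quot_proj c (repr z) = z.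
Proof. exact: reprK. Qed.

Section KernelCongruence.
Variables (M X : monoidType) (f : mon_hom M X).

Definition ker_rel : rel M := fun x y => f x == f y.

Lemma ker_refl : reflexive ker_rel. Proof. by move=> x; apply/eqP. Qed.

Lemma ker_sym : symmetric ker_rel. Proof. by move=> x y; apply: eq_sym. Qed.

Lemma ker_trans : transitive ker_rel.
Proof. by move=> y x z /eqP xy /eqP yz; apply/eqP; rewrite xy. Qed.

Lemma ker_mul (x x' y y' : M) :
  ker_rel x x' -> ker_rel y y' -> ker_rel (x * y) (x' * y').
Proof. by move=> /eqP xx' /eqP yy'; apply/eqP; rewrite !gmulfM xx' yy'. Qed.

Definition ker_cong : congruence M :=
  @Congruence M (EquivRel ker_rel ker_refl ker_sym ker_trans) ker_mul.

End KernelCongruence.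

Section FactorThroughQuotient.
Variables (M X : monoidType) (c : congruence M) (f : mon_hom M X).
Hypothesis cf : forall x y : M, c x y -> f x = f y.

Definition quot_lift_fun (z : quot c) : X := f (repr z).

Lemma quot_lift_proj (x : M) : quot_lift_fun (quot_proj c x) = f x.
Proof. by apply: cf; apply/quot_projP; apply: quot_proj_repr. Qed.

Lemma quot_lift_morph : monoid_morphism quot_lift_fun.
Proof.
split=> [|z t]; first by rewrite -(gmulf1 (s := quot_proj c)) quot_lift_proj gmulf1.
by rewrite -[z]quot_proj_repr -[t]quot_proj_repr -gmulfM !quot_lift_proj gmulfM.
Qed.

Definition quot_lift : mon_hom (quot c) X :=
  HB.pack quot_lift_fun
    (isUMagmaMorphism.Build (quot c) X quot_lift_fun quot_lift_morph).

End FactorThroughQuotient.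

Section FactorThroughIdempotents.
Variables (M : inverseMonoidType) (X : monoidType) (f : mon_hom X M).
Hypothesis fE : forall x : X, f x \in idem M.

Definition idem_lift_fun (x : X) : idempotents M := Idempotent (fE x).

Lemma idem_lift_morph : monoid_morphism idem_lift_fun.
Proof.
split=> [|x y]; apply: val_inj; first exact: (gmulf1 (s := f)).
by rewrite [RHS](gmulfM (s := idem_incl M)) [LHS](gmulfM (s := f)).
Qed.

Definition idem_lift : mon_hom X (idempotents M) :=
  HB.pack idem_lift_fun
    (isUMagmaMorphism.Build X (idempotents M) idem_lift_fun idem_lift_morph).

End FactorThroughIdempotents.

(** The image is an idempotent of the group [M / sigma]. *)
Lemma quot_proj_sigma_idem (M : inverseMonoidType) (e : M) :
  e \in idem M -> quot_proj (sigma M) e = 1.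
Proof.
move=> /idemP ee; have [y [ey _]] := sigma_is_group (quot_proj (sigma M) e).
by rewrite -[LHS]mulg1 -ey mulgA -gmulfM ee.
Qed.

(** The morphism [f] maps inverses in the inverse monoid to group inverses in
    its image, so [M / ker f] is a group, and sigma is the least congruence
    with this property. *)
Lemma sigma_sub_ker (M : inverseMonoidType) (X : monoidType)
    (f : mon_hom M X) :
  (forall e : M, e \in idem M -> f e = 1) ->
  forall x y : M, sigma M x y -> f x = f y.
Proof.
move=> fE x y xy; apply/eqP; apply: (sigma_min (c := ker_cong f)) xy => z.
rewrite -[z]quot_proj_repr; move: (repr z) => {z} u.
have [v [[uvu vuv] _]] := exists_unique_inverse u.
exists (quot_proj _ v); rewrite -!gmulfM -(gmulf1 (s := quot_proj (ker_cong f))).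
by split; apply/quot_projP/eqP; rewrite gmulf1 fE //; apply/idemP;
  rewrite mulgA ?uvu ?vuv.
Qed.

Lemma sigma_is_cokernel (M : inverseMonoidType) :
  is_cokernel (idem_incl M) (quot_proj (sigma M)).
Proof.
split=> [n|X f fk]; first exact: quot_proj_sigma_idem (valP n).
have fE (e : M) : e \in idem M -> f e = 1 by move=> eE; apply: (fk (Idempotent eE)).
exists (quot_lift (sigma_sub_ker fE)); split=> [x|g gq z].
  exact: (quot_lift_proj (sigma_sub_ker fE)).
rewrite -[z]quot_proj_repr [LHS]gq.
by rewrite -(quot_lift_proj (sigma_sub_ker fE)).
Qed.

Lemma nat_le1_idem (M : inverseMonoidType) (x : M) :
  nat_le x 1 -> x \in idem M.
Proof. by case=> e eE ->; rewrite mulg1. Qed.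

(** If [1 = e * m] with [e] idempotent, multiplying by [e] gives [e = 1]. *)
Lemma nat_le_max1 (M : inverseMonoidType) (m : M) : nat_le 1 m -> m = 1.
Proof.
case=> e /idemP ee em.
have e1 : e = 1 by rewrite -[LHS]mulg1 em mulgA ee.
by rewrite em e1 mul1g.
Qed.

(** The greatest element of the class of [1] lies above [1], hence is [1] by
    maximality, so the whole class lies below [1]. *)
Lemma F_inverse_sigma1_idem (M : inverseMonoidType) :
  F_inverse M -> forall x : M, sigma M 1 x -> x \in idem M.
Proof.
move=> /(_ 1) [m _ mmax] x x1; apply: nat_le1_idem.
by rewrite -(nat_le_max1 (mmax 1 (equiv_refl _ _))); apply: mmax.
Qed.

Lemma E_unitary_is_kernel (M : inverseMonoidType) :
  (forall x : M, sigma M 1 x -> x \in idem M) ->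
  is_kernel (idem_incl M) (quot_proj (sigma M)).
Proof.
move=> EU; split=> [n|X f qf]; first exact: quot_proj_sigma_idem (valP n).
have fE (x : X) : f x \in idem M.
  by apply/EU/quot_projP; rewrite qf gmulf1.
exists (idem_lift fE); split=> [x //|g kg x].
by apply: val_inj; apply: kg.
Qed.

Theorem theorem2p2 (M : inverseMonoidType) :
  weakly_schreier_extension (idem_incl M) (quot_proj (sigma M)) <-> F_inverse M.
Proof.
split=> [[_ [s [sK sch]]] x | FM].
  exists (s (quot_proj (sigma M) x)) => [|y /quot_projP ->].
    by apply/quot_projP; rewrite sK.
  by have [n yE] := sch y; exists (val n); [apply: valP | apply: yE].
split.
  split; last exact: sigma_is_cokernel.
  exact/E_unitary_is_kernel/F_inverse_sigma1_idem.
have /choice [s sP] (z : quot (sigma M)) : exists m : M,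
    quot_proj (sigma M) m = z /\
    forall y : M, quot_proj (sigma M) y = z -> nat_le y m.
  have [m zm mmax] := FM (repr z); exists m; split.
    by rewrite -[RHS]quot_proj_repr; apply/esym/quot_projP.
  by move=> y yz; apply/mmax/quot_projP; rewrite yz quot_proj_repr.
exists s; split=> [z | g]; first by have [] := sP z.
have [_ /(_ g erefl) [e eE gE]] := sP (quot_proj (sigma M) g).
by exists (Idempotent eE).
Qed.
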